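(* Let $T>0$. There exists a constant $C>0$ such that, for all integers $n\ge1$, all $x\in\mathbb{R}$ and all $0\le t\le s\le T$, $$W_\psi\left(B^{n,t,x}_s,B^{t,x}_s\right)\le C\left(\frac{T}{n}\right)^{1/2}.$$
   Context: $B=\{B_t\}_{0\le t\le T}$ is a standard real Brownian motion and $B^{t,x}_s:=x+B_s-B_t$. $(\xi_k)_{k\ge1}$ are i.i.d. with $\mathbb{P}(\xi_k=\pm1)=\frac12$ (on some probability space, not necessarily the one carrying $B$). For $n\ge1$, $h:=T/n$, $B^n_t:=\sqrt h\sum_{k=1}^{[t/h]}\xi_k$ for $0\le t\le T$ ($[\cdot]$ the integer part), and $B^{n,t,x}_s:=x+B^n_s-B^n_t$. Let $\psi(x)=e^{|x|}-1$. The Orlicz norm of a real random variable $X$ is $\|X\|_\psi:=\inf\{a>0:\mathbb{E}[\psi(X/a)]\le1\}$ with $\inf\emptyset:=+\infty$. For real random variables $X,Y$ with laws $\mu,\nu$, $W_\psi(X,Y)=W_\psi(\mu,\nu):=\inf\{\|X'-Y'\|_\psi:\ \mathrm{law}(X')=\mu,\ \mathrm{law}(Y')=\nu\}$, the infimum being over all couplings. *)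

(* Defs.v *)
From HB Require Import structures.
From mathcomp Require Import all_boot all_order all_algebra.
From mathcomp Require Import all_classical all_reals all_analysis.
From mathcomp Require Import measurable_realfun.

Set Implicit Arguments.
Unset Strict Implicit.
Unset Printing Implicit Defensive.

Import Order.TTheory GRing.Theory Num.Theory.
Import numFieldNormedType.Exports.

Local Open Scope classical_set_scope.
Local Open Scope ring_scope.

(* Laws are compared on measurable sets only: the value of a measure on a
   non-measurable set carries no meaning. *)
Definition has_law d (Omega : measurableType d) (R : realType)
    (P : probability Omega R) (X : {RV P >-> R}) (mu : set R -> \bar R) : Prop :=
  forall A : set R, measurable A -> distribution P X A = mu A.

Arguments has_law {d Omega R} P X mu.

Definition independent_RVs d (Omega : measurableType d) (R : realType)
    (P : probability Omega R) (I : eqType) (D : set I)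
    (X : I -> {RV P >-> R}) : Prop :=
  forall (J : seq I) (A : I -> set R),
    uniq J -> [set` J] `<=` D ->
    (forall i, i \in J -> measurable (A i)) ->
    (P (\bigcap_(i in [set` J]) X i @^-1` A i) =
     \prod_(i <- J) P (X i @^-1` A i))%E.

Arguments independent_RVs {d Omega R} P {I} D X.

(* B is indexed by all of R, but only its restriction to `[0, T] matters.
   The second argument of normal_prob is the standard deviation; increments
   over an interval of length 0 vanish and are left out of the Gaussian
   clause. *)
Definition standard_Brownian_motion d (Omega : measurableType d)
    (R : realType) (P : probability Omega R) (T : R)
    (B : R -> {RV P >-> R}) : Prop :=
  [/\ {ae P, forall w, B 0 w = 0},
      forall (m : nat) (u : nat -> R),
        (forall i, (i <= m)%N -> 0 <= u i <= T) ->
        (forall i, (i < m)%N -> u i <= u i.+1) ->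
        independent_RVs P `I_m (fun i => B (u i.+1) - B (u i)),
      forall s t : R, 0 <= s -> s < t -> t <= T ->
        has_law P (B t - B s) (normal_prob 0 (Num.sqrt (t - s)))
    & {ae P, forall w, {within `[0, T], continuous (fun t => B t w)}}].

Arguments standard_Brownian_motion {d Omega R} P T B.

Definition iid_signs d (Omega : measurableType d) (R : realType)
    (P : probability Omega R) (xi : nat -> {RV P >-> R}) : Prop :=
  independent_RVs P [set k | (1 <= k)%N] xi /\
  forall k, (1 <= k)%N ->
    P (xi k @^-1` [set 1]) = (2^-1)%:E /\ P (xi k @^-1` [set -1]) = (2^-1)%:E.

Arguments iid_signs {d Omega R} P xi.

(* For t >= 0, Num.truncn (t / h) is the integer part of t / h. *)
Definition random_walk d (Omega : measurableType d) (R : realType)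
    (P : probability Omega R) (T : R) (xi : nat -> {RV P >-> R})
    (n : nat) (t : R) : {RV P >-> R} :=
  let h := T / n%:R in
  Num.sqrt h \o* (\sum_(1 <= k < (Num.truncn (t / h)).+1) xi k).

Arguments random_walk {d Omega R} P T xi n t.

Definition started_at d (Omega : measurableType d) (R : realType)
    (P : probability Omega R) (Z : R -> {RV P >-> R}) (t x s : R) :
    {RV P >-> R} :=
  cst x \+ (Z s - Z t).

Arguments started_at {d Omega R} P Z t x s.

Definition psi (R : realType) (x : R) : R := expR `|x| - 1.

(* ereal_inf set0 = +oo. *)
Definition orlicz_norm d (Omega : measurableType d) (R : realType)
    (P : probability Omega R) (X : {RV P >-> R}) : \bar R :=
  ereal_inf [set a%:E | a in
    [set a : R | 0 < a /\ ('E_P[fun w => psi (X w / a)] <= 1)%E]].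

Arguments orlicz_norm {d Omega R} P X.

Definition W_psi_law (R : realType) (mu nu : set R -> \bar R) : \bar R :=
  ereal_inf [set r | exists d (Omega : measurableType d)
      (P : probability Omega R) (X' Y' : {RV P >-> R}),
    [/\ has_law P X' mu, has_law P Y' nu & r = orlicz_norm P (X' - Y')]].

Definition W_psi d1 d2 (Omega1 : measurableType d1) (Omega2 : measurableType d2)
    (R : realType) (P1 : probability Omega1 R) (P2 : probability Omega2 R)
    (X : {RV P1 >-> R}) (Y : {RV P2 >-> R}) : \bar R :=
  W_psi_law (distribution P1 X) (distribution P2 Y).

Arguments W_psi {d1 d2 Omega1 Omega2 R} P1 P2 X Y.

(* Main.v *)
Require Import Defs.
From HB Require Import structures.
From mathcomp Require Import all_boot all_order all_algebra.
From mathcomp Require Import all_classical all_reals all_analysis.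
From mathcomp Require Import measurable_realfun.
From mathcomp Require Import ring lra zify.

(** It suffices to exhibit, for each [n], [t] and [s], one good coupling of the
two increments. In units of [h = T / n], the increment of the walk is a sum of
[m] independent signs and the Brownian increment is [Num.sqrt v * Z], with [Z]
standard normal and [v] within 1 of [m]. The coupling is the quantile coupling,
built on the space of the Brownian motion: the Brownian marginal is kept and
the sum of signs is replaced by the binomial quantile of [Phi Z]
([quantile_coupling_exists]). The core is a Tusnady-type inequality
([quantile_gap]): the coupled values differ by at most [300 + 60 * Z ^+ 2],
whatever [m] is. Since E exp(Z^2 / 4) = sqrt 2, a fixed multiple of this
difference has exponential moment at most 2 ([orlicz_norm_le_normal]), and the
Orlicz norm of the difference is [O(Num.sqrt h)] after scaling back.

The inequality amounts to a comparison of binomial with normal tails, which is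
made without Stirling's formula. If two probability vectors are in monotone
likelihood ratio, their partial sums are ordered ([ler_partial_sum_of_mlr]), so
only ratios of consecutive masses matter. The binomial ratio at the value
[k = 2 * i - m] is [(1 - y) / (1 + y)] with [y = (k + 1) / (m + 1)], at most
[expR (- 2 * y + y ^+ 2)] when [- 1/2 <= y] ([expR_ratio_bound]). The normal law
of variance [M = m + 1] is cut at the points
[bend M k = k - 16 - k ^+ 2 / (4 * M)], and the masses of its cells have larger
ratios: the quadratic term produces the term in [y ^+ 2], the shift absorbs
discretization errors ([bent_cdf_increment]), and the part of the law left of
about [- M / 2] is lumped in a single cell ([bent_cdf_left]). Hence the binomial
distribution function at [k] is at least [Phi (bend M k / Num.sqrt M)] for [k]
above about [- m / 2] ([bent_cdf_le_bin_cdf]). This and its mirror image bracket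
the coupled values within [16 + k ^+ 2 / (4 * M)] of each other when [`|k|] is
at most about [m / 2]; beyond, [Num.sqrt M * Z] is itself of order [m], so that
[m] is [O(1 + Z ^+ 2)] and the triangle inequality suffices. *)

Set Implicit Arguments.
Unset Strict Implicit.
Unset Printing Implicit Defensive.

Import Order.TTheory GRing.Theory Num.Theory.
Import numFieldNormedType.Exports.

Local Open Scope classical_set_scope.
Local Open Scope ring_scope.

(** * The normal distribution function *)

Lemma ler_of_ge0_derive (R : realType) (f df : R -> R) (a b : R) : a <= b ->
  (forall x : R, x \in `[a, b] -> is_derive x 1 f (df x)) ->
  (forall x, x \in `[a, b] -> 0 <= df x) -> f a <= f b.
Proof.
move=> ab fdf df0.
have fdf' x : x \in `]a, b[ -> is_derive x 1 f (df x).
  by move=> xab; apply: fdf; exact: subset_itv_oo_cc xab.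
have cf : {within `[a, b], continuous f}.
  by apply: derivable_within_continuous => x /fdf dx; exact: ex_derive.
have [c cab fE] := MVT_segment ab fdf' cf.
by rewrite -subr_ge0 fE mulr_ge0 ?subr_ge0// df0.
Qed.

Lemma eq_of_derive0 (R : realType) (f : R -> R) :
  (forall x : R, is_derive x 1 f 0) -> forall x y, f x = f y.
Proof.
move=> f0 x y; wlog xy : x y / x <= y => [H|].
  by case/orP: (le_total x y) => [/H|/H ->].
have cf : {within `[x, y], continuous f}.
  by apply: derivable_within_continuous => z _; have dz := f0 z;
     exact: ex_derive.
have [c _] := MVT_segment xy (fun z _ => f0 z) cf.
by rewrite mul0r => /eqP; rewrite subr_eq0 => /eqP.
Qed.

Definition normal_cdf (R : realType) (s x : R) : R :=
  fine (normal_prob 0 s `]-oo, x]%classic).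

Definition Phi (R : realType) (x : R) : R := normal_cdf 1 x.

Section Phi.
Context {R : realType}.
Implicit Types x y w p s : R.

Lemma normal_cdfE s x :
  normal_prob 0 s `]-oo, x]%classic = (normal_cdf s x)%:E.
Proof. by rewrite fineK// fin_num_measure. Qed.

Lemma is_derive_normal_cdf s x : 0 < s ->
  is_derive x 1 (normal_cdf s) (normal_pdf 0 s x).
Proof.
move=> s0; have xx1 : x < x + 1 by rewrite ltrDl.
have intf : (@lebesgue_measure R).-integrable `]-oo, x + 1]
    (EFin \o normal_pdf 0 s).
  by apply: integrableS (integrable_normal_pdf 0 s).
have [|F1 F2] := continuous_FTC1 xx1 intf (ltNyr _).
  by apply: continuous_normal_pdf; rewrite gt_eqF.
apply: DeriveDef; first exact: F1.
by rewrite -derive1E; exact: F2.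
Qed.

Let idR : measurableTypeR R -> R := idfun.

#[local] HB.instance Definition _ :=
  @isMeasurableFun.Build _ _ _ _ idR (@measurable_id _ _ setT).

Let cdf_idR s x :
  cdf (idR : {RV (normal_prob 0 s) >-> R}) x = (normal_cdf s x)%:E.
Proof. by rewrite -normal_cdfE. Qed.

Lemma normal_cdf_cvgNy s : normal_cdf s x @[x --> -oo] --> (0 : R).
Proof.
apply/fine_cvg.
have := cvg_cdfNy0 (idR : {RV (normal_prob 0 s) >-> R}).
by apply: cvg_trans; apply: near_eq_cvg; near=> x; rewrite cdf_idR normal_cdfE.
Unshelve. all: by end_near. Qed.

Lemma normal_cdf_cvgy s : normal_cdf s x @[x --> +oo] --> (1 : R).
Proof.
apply/fine_cvg.
have := cvg_cdfy1 (idR : {RV (normal_prob 0 s) >-> R}).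
by apply: cvg_trans; apply: near_eq_cvg; near=> x; rewrite cdf_idR normal_cdfE.
Unshelve. all: by end_near. Qed.

Lemma Phi_derive x :
  is_derive x 1 (@Phi R) (normal_peak 1 * expR (- x ^+ 2 / 2)).
Proof.
apply: is_derive_eq; first exact: (@is_derive_normal_cdf 1).
by rewrite normal_pdfE ?oner_neq0// /normal_fun subr0 expr1n.
Qed.

(** The two sides have the same derivative in [x] and both vanish at -oo. *)
Lemma normal_cdf_scale s x : 0 < s -> normal_cdf s (s * x) = Phi x.
Proof.
move=> s0; pose g y := normal_cdf s (s * y) - Phi y.
have g'0 (y : R) : is_derive y 1 g 0.
  have d1 := is_derive_normal_cdf (s * y) s0.
  have d2 : is_derive y 1 ( *%R s) s.
    by apply: is_derive_eq; exact: mulr1.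
  have d3 := Phi_derive y.
  have d4 : is_derive y 1 (normal_cdf s \o *%R s) (normal_pdf 0 s (s * y) * s).
    exact: is_derive1_comp.
  apply: (is_derive_eq (is_deriveB _ _)).
  rewrite normal_pdfE ?gt_eqF// /normal_fun subr0 /normal_peak expr1n mul1r.
  rewrite -mulrnAr sqrtrM ?sqr_ge0// sqrtr_sqr gtr0_norm// invfM.
  have -> : - (s * y) ^+ 2 / (s ^+ 2 *+ 2) = - y ^+ 2 / 2.
    by field; rewrite gt_eqF.
  by field; rewrite !gt_eqF// sqrtr_gt0 mulrn_wgt0// pi_gt0.
have gNy : g y @[y --> -oo] --> (0 : R).
  rewrite -[X in _ --> X](subr0 0); apply: cvgB; last exact: normal_cdf_cvgNy.
  have sNy : s * y @[y --> -oo] --> -oo.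
    under eq_cvg do rewrite mulrC.
    by apply: gt0_cvgMlNy => //; exact: cvg_id.
  exact: (cvg_comp _ _ sNy (normal_cdf_cvgNy s)).
suff : g x = 0 by move=> /eqP; rewrite subr_eq0 => /eqP.
apply: (cvg_unique _ _ gNy) => //.
by rewrite (_ : g = cst (g x)); [exact: cvg_cst|apply/funext => y];
  exact: eq_of_derive0.
Qed.

(** The density is even, so [Phi (- y) + Phi y] has zero derivative; it tends
    to 1 at +oo. *)
Lemma PhiN x : Phi (- x) = 1 - Phi x.
Proof.
pose g y := @Phi R (- y) + Phi y.
have g'0 (y : R) : is_derive y 1 g 0.
  have d1 := Phi_derive (- y); have d2 := Phi_derive y.
  have d3 : is_derive y 1 (@Phi R \o -%R)
      (normal_peak 1 * expR (- (- y) ^+ 2 / 2) * -1) by exact: is_derive1_comp.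
  apply: (is_derive_eq (is_deriveD _ _)).
  by rewrite sqrrN mulrN1 addNr.
have gy : g y @[y --> +oo] --> (1 : R).
  rewrite -[X in _ --> X](add0r 1); apply: cvgD; last exact: normal_cdf_cvgy.
  have Ny : - y @[y --> +oo] --> (-oo : set_system R).
    by apply/cvgNrNy; exact: cvg_id.
  exact: (cvg_comp _ _ Ny (normal_cdf_cvgNy 1)).
suff : g x = 1 by move=> <-; rewrite addrK.
apply: (cvg_unique _ _ gy) => //.
by rewrite (_ : g = cst (g x)); [exact: cvg_cst|apply/funext => y];
  exact: eq_of_derive0.
Qed.

Lemma ler_Phi : {mono (@Phi R) : x y / x <= y}.
Proof.
apply: le_mono => x y xy.
have cf : {within `[x, y], continuous (@Phi R)}.
  by apply: derivable_within_continuous => z _;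
     have dz := Phi_derive z; exact: ex_derive.
have [c _ /eqP] := MVT xy (fun z _ => Phi_derive z) cf.
rewrite -subr_gt0 => /eqP ->.
by rewrite mulr_gt0 ?subr_gt0// mulr_gt0 ?expR_gt0// normal_peak_gt0 ?oner_neq0.
Qed.

Lemma ltr_Phi : {mono (@Phi R) : x y / x < y}.
Proof. exact/leW_mono/ler_Phi. Qed.

Lemma Phi_gt0 x : 0 < Phi x.
Proof.
apply: (@le_lt_trans _ _ (Phi (x - 1))); first exact: fine_ge0.
by rewrite ltr_Phi gtrBl.
Qed.

Lemma Phi_lt1 x : Phi x < 1.
Proof. by rewrite -subr_gt0 -PhiN Phi_gt0. Qed.

Lemma Phi_onto p : 0 < p < 1 -> exists x, Phi x = p.
Proof.
move=> /andP[p0 p1].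
have [a ap] : exists a, Phi a <= p.
  have /cvgrPdist_lt/(_ _ p0)[a [_ aP]] := normal_cdf_cvgNy 1.
  exists (a - 1); have := aP (a - 1); rewrite gtrBl ltr01 => /(_ isT).
  by rewrite sub0r normrN gtr0_norm ?Phi_gt0// => /ltW.
have [b bp] : exists b, p <= Phi b.
  have p1' : 0 < 1 - p by rewrite subr_gt0.
  have /cvgrPdist_lt/(_ _ p1')[b [_ bP]] := normal_cdf_cvgy 1.
  exists (b + 1); have := bP (b + 1); rewrite ltrDl ltr01 => /(_ isT).
  by rewrite gtr0_norm ?subr_gt0 ?Phi_lt1// ltrD2l ltrN2 => /ltW.
have ab : a <= b by rewrite -ler_Phi (le_trans ap).
have cf : {within `[a, b], continuous (@Phi R)}.
  by apply: derivable_within_continuous => z _;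
     have dz := Phi_derive z; exact: ex_derive.
have pab : Num.min (Phi a) (Phi b) <= p <= Num.max (Phi a) (Phi b).
  by rewrite (min_idPl _) ?(max_idPr _) ?ler_Phi// ap bp.
by have [c _ cp] := IVT ab cf pab; exists c.
Qed.

End Phi.

(** * Elementary bounds for the ratio of consecutive masses *)

Section exponential_bounds.
Context {R : realType}.
Implicit Types x y : R.

Lemma expR_ge_quadratic x : 0 <= x -> 1 + x + x ^+ 2 / 2 <= expR x.
Proof.
move=> x0; pose f (z : R) := expR z - (1 + z + z ^+ 2 / 2).
suff : f 0 <= f x by rewrite /f expR0 expr0n/= mul0r !addr0 subrr subr_ge0.
apply: (@ler_of_ge0_derive _ f (fun z => expR z - (1 + z))) => // z _.
  apply: (is_derive_eq (is_deriveB _ _)).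
  by rewrite /GRing.scale/=; field.
by rewrite subr_ge0 expR_ge1Dx.
Qed.

(** ln ((1 - y) / (1 + y)) = - 2 y - 2 y^3 / 3 - ...: the remainder is positive
    only for [y < 0], where [y ^+ 2] dominates it down to [y = - 1/2]. For
    [0 <= y] the exponential is bounded below by the square of
    [1 - y + y ^+ 2 / 2], for [y < 0] by its quadratic Taylor polynomial. *)
Lemma expR_ratio_bound y : - 2^-1 <= y <= 1 ->
  1 - y <= (1 + y) * expR (- (2 * y) + y ^+ 2).
Proof.
move=> /andP[ly y1]; have [y0|y0] := leP 0 y.
  pose w := 1 - y + y ^+ 2 / 2.
  have w0 : 0 <= w by rewrite /w; nra.
  have le_w : w ^+ 2 <= expR (- (2 * y) + y ^+ 2).
    have -> : - (2 * y) + y ^+ 2 = 2%:R * (- y + y ^+ 2 / 2) by field.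
    rewrite expRM_natl lerXn2r ?nnegrE ?expR_ge0//.
    by rewrite /w -addrA expR_ge1Dx.
  apply: (@le_trans _ _ ((1 + y) * w ^+ 2)); last by rewrite ler_wpM2l//; lra.
  have -> : (1 + y) * w ^+ 2 = 1 - y + y ^+ 3 * (1 - 3 / 4 * y + y ^+ 2 / 4).
    by rewrite /w; field.
  by rewrite lerDl mulr_ge0 ?exprn_ge0//; nra.
set z := - y; have z0 : 0 < z by rewrite /z oppr_gt0.
have z2 : z <= 2^-1 by rewrite /z; lra.
have -> : y = - z by rewrite /z opprK.
move: z z0 z2 => z z0 z2; rewrite mulrN opprK sqrrN.
have u0 : 0 <= 2 * z + z ^+ 2 by nra.
have := expR_ge_quadratic u0; set u := 2 * z + z ^+ 2 => eu.
apply: (@le_trans _ _ ((1 - z) * (1 + u + u ^+ 2 / 2))); last first.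
  by rewrite ler_wpM2l//; lra.
have -> : (1 - z) * (1 + u + u ^+ 2 / 2) =
    1 + z + z ^+ 2 * ((1 - 2 * z) * (1 + z) + z ^+ 2 * (1 - z) / 2).
  by rewrite /u; field.
rewrite lerDl mulr_ge0 ?sqr_ge0// addr_ge0// mulr_ge0 ?invr_ge0//; try lra.
by rewrite mulr_ge0 ?sqr_ge0//; lra.
Qed.

(** ln 4 is about 1.386; the quadratic Taylor bound at 7/40 is sharp enough to
    survive three squarings. *)
Lemma expR_ge4 : 4 <= expR (7 / 5 : R).
Proof.
have dbl x c : 0 <= c -> c <= expR x -> c * c <= expR (x + x).
  by move=> c0 cx; rewrite expRD ler_pM.
have e1 : 11903 / 10000 <= expR (7 / 40 : R).
  by apply: le_trans (expR_ge_quadratic _); lra.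
have e2 : 14168 / 10000 <= expR (7 / 20 : R).
  by have := dbl _ _ _ e1; rewrite (_ : 7 / 40 + 7 / 40 = 7 / 20); lra.
have e3 : 2007 / 1000 <= expR (7 / 10 : R).
  by have := dbl _ _ _ e2; rewrite (_ : 7 / 20 + 7 / 20 = 7 / 10); lra.
by have := dbl _ _ _ e3; rewrite (_ : 7 / 10 + 7 / 10 = 7 / 5); lra.
Qed.

End exponential_bounds.

(** The point at which the centred normal law of variance [M] is cut to match
    the value [k] of a walk of [M - 1] steps. The shift 16 absorbs errors of
    relative size [1 / M] in the ratios of consecutive cells. The quadratic
    term moves the cuts by at most a multiple of [k ^+ 2 / M], which the
    coupling tolerates; it makes the normal cells to the left of 0 decay as
    fast as the binomial weights. The factor 1/4 keeps [bend M] increasing on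
    the range of the walk. *)
Definition bend (R : realType) (M k : R) : R := k - 16 - k ^+ 2 / (4 * M).

Section bend.
Context {R : realType}.
Implicit Types M y k : R.

(** [(1 - k / (2 * M)) * expR _] is, up to a constant, the derivative of
    [k |-> Phi (bend M k / Num.sqrt M)], and [(1 - y) / (1 + y)] is the ratio
    of consecutive binomial weights at [k = M * y - 1]. With [h = (k + 1) / M],
    the exponent gained from [k] to [k + 2] is [- E], where
    [E <= 2 * h - 5/4 * h ^+ 2 - 16 / M] because [h <= 1]. Compared with the
    exponent [2 * y - y ^+ 2] of [expR_ratio_bound] there is a surplus of
    [h ^+ 2 / 4], and the term [16 / M], which comes from the shift, pays for
    [h - y = O(1 / M)] and for the change of the factor [1 - k / (2 * M)]. *)
Lemma bend_density_ratio M y k : 2 <= M ->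
  - 2^-1 <= y -> y <= 1 - 2 / M -> M * y - 1 <= k <= M * y + 1 ->
  (1 - y) * ((1 - k / (2 * M)) * expR (- (bend M k) ^+ 2 / (2 * M))) <=
  (1 + y) *
    ((1 - (k + 2) / (2 * M)) * expR (- (bend M (k + 2)) ^+ 2 / (2 * M))).
Proof.
move=> M2 ly y1 /andP[k1 k2].
have M0 : 0 < M by lra.
pose e := M^-1; have e0 : 0 < e by rewrite invr_gt0.
have eM : e * M = 1 by rewrite mulVf// gt_eqF.
have e2 : e <= 2^-1 by rewrite lef_pV2 ?posrE.
pose h := (k + 1) * e.
have kE : k = h * M - 1 by rewrite /h -mulrA eM; ring.
have hy : y <= h by rewrite /h; nra.
have hy2 : h <= y + 2 * e by rewrite /h; nra.
have h1 : h <= 1 by move: y1; rewrite -/e; lra.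
have d1E : 1 - k / (2 * M) = 1 - h / 2 + e / 2.
  by rewrite kE /e; field; rewrite gt_eqF.
have d2E : 1 - (k + 2) / (2 * M) = 1 - h / 2 - e / 2.
  by rewrite kE /e; field; rewrite gt_eqF.
have d2_ge : 4^-1 <= 1 - (k + 2) / (2 * M) by rewrite d2E; lra.
have d1_le : 1 - k / (2 * M) <= (1 - (k + 2) / (2 * M)) * expR (4 * e).
  apply: (@le_trans _ _ ((1 - (k + 2) / (2 * M)) * (1 + 4 * e))).
    by rewrite d1E; move: d2_ge; rewrite d2E; nra.
  by rewrite ler_wpM2l ?expR_ge1Dx//; lra.
(* With e = 1 / M and h = (k + 1) / M everything is a polynomial in e, h. *)
pose E := (bend M (k + 2) ^+ 2 - bend M k ^+ 2) / (2 * M).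
have EE : E = (1 - h / 2) * (2 * h - h ^+ 2 / 2 - 32 * e - e ^+ 2 / 2).
  by rewrite /E /bend kE /e; field; rewrite gt_eqF.
have E_le : E + 4 * e <= 2 * y - y ^+ 2.
  have -> : E = 2 * h - 5 / 4 * h ^+ 2 - 16 * e
      - (h ^+ 2 * (1 - h) / 4 + 16 * e * (1 - h) + (1 - h / 2) * e ^+ 2 / 2).
    by rewrite EE; field.
  have p1 : 0 <= h ^+ 2 * (1 - h) / 4.
    by rewrite divr_ge0// mulr_ge0 ?sqr_ge0//; lra.
  have p2 : 0 <= 16 * e * (1 - h) by rewrite mulr_ge0//; lra.
  have p3 : 0 <= (1 - h / 2) * e ^+ 2 / 2.
    by rewrite divr_ge0// mulr_ge0 ?sqr_ge0//; lra.
  have : 2 * h - 5 / 4 * h ^+ 2 - 16 * e + 4 * e <= 2 * y - y ^+ 2.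
    pose d := h - y; have -> : h = y + d by rewrite /d; ring.
    have d0 : 0 <= d by rewrite /d; lra.
    have d2 : d <= 2 * e by rewrite /d; lra.
    have := mulr_ge0 d0 (_ : 0 <= y + 2^-1); rewrite -lerBlDr sub0r => /(_ ly).
    by have := sqr_ge0 y; have := sqr_ge0 d; nra.
  by lra.
have ED : - bend M (k + 2) ^+ 2 / (2 * M) = - bend M k ^+ 2 / (2 * M) - E.
  by rewrite /E; field; rewrite gt_eqF.
rewrite ED expRD.
rewrite [X in X <= _]mulrA [X in _ <= X](_ : _ = (1 + y) *
  (1 - (k + 2) / (2 * M)) * expR (- E) * expR (- bend M k ^+ 2 / (2 * M)));
  last by ring.
rewrite ler_wpM2r ?expR_ge0//.
have yb : - 2^-1 <= y <= 1 by rewrite ly/=; move: y1; rewrite -/e; lra.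
have := expR_ratio_bound yb; set X := expR (_ + _) => yX.
have XE : X * expR (4 * e) <= expR (- E) by rewrite -expRD ler_expR; lra.
apply: (@le_trans _ _ ((1 + y) * X * ((1 - (k + 2) / (2 * M)) * expR (4 * e)))).
  by apply: ler_pM => //; move: y1; rewrite ?d1E -/e; lra.
rewrite [leLHS](_ : _ =
  (1 + y) * (1 - (k + 2) / (2 * M)) * (X * expR (4 * e))); last by ring.
by rewrite ler_wpM2l// mulr_ge0//; lra.
Qed.

End bend.

(** * Cells of the normal law *)

Section bent_cdf.
Context {R : realType}.
Implicit Types M y k : R.

Definition bent_cdf M k : R := Phi (bend M k / Num.sqrt M).

Lemma is_derive_bent_cdf M k : 0 < M ->
  is_derive k 1 (bent_cdf M) (normal_peak 1 / Num.sqrt M *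
    ((1 - k / (2 * M)) * expR (- (bend M k) ^+ 2 / (2 * M)))).
Proof.
move=> M0.
pose g (z : R) := bend M z / Num.sqrt M.
have dg : is_derive k 1 g ((1 - k / (2 * M)) / Num.sqrt M).
  apply: is_derive_eq.
  by rewrite /GRing.scale/=; field; rewrite !gt_eqF ?sqrtr_gt0.
have dPhi := Phi_derive (g k).
have -> : bent_cdf M = @Phi R \o g by [].
apply: (is_derive_eq (is_derive1_comp dPhi dg)).
rewrite /g expr_div_n sqr_sqrtr ?ltW//.
have -> : - (bend M k ^+ 2 / M) / 2 = - bend M k ^+ 2 / (2 * M).
  by field; rewrite gt_eqF.
by ring.
Qed.

(** Consecutive cells [k, k + 2] and [k + 2, k + 4] compare as their densities
    do pointwise ([bend_density_ratio]): the difference of the two sides is the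
    increment over [k, k + 2] of a function with nonnegative derivative. *)
Lemma bent_cdf_increment M k : 2 <= M -> - (M / 2) <= k + 1 <= M - 2 ->
  (M - (k + 1)) * (bent_cdf M (k + 2) - bent_cdf M k) <=
  (M + (k + 1)) * (bent_cdf M (k + 4) - bent_cdf M (k + 2)).
Proof.
move=> M2 /andP[lk k1]; have M0 : 0 < M by lra.
pose y := (k + 1) / M; have yM : k + 1 = M * y by rewrite mulrC divfK// gt_eqF.
have kE : k = M * y - 1 by rewrite -yM addrK.
have ly : - 2^-1 <= y by rewrite /y ler_pdivlMr//; lra.
have y1 : y <= 1 - 2 / M.
  by rewrite /y ler_pdivrMr// mulrBl divfK ?gt_eqF// mul1r.
rewrite [leLHS](_ : _ = M * ((1 - y) * (bent_cdf M (k + 2) - bent_cdf M k)));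
  last by rewrite yM; ring.
rewrite [leRHS](_ : _ =
    M * ((1 + y) * (bent_cdf M (k + 4) - bent_cdf M (k + 2))));
  last by rewrite yM; ring.
rewrite ler_pM2l//.
pose D z := (1 + y) * bent_cdf M (z + 2) - (1 - y) * bent_cdf M z.
suff : D k <= D (k + 2).
  by rewrite /D (_ : k + 2 + 2 = k + 4); [lra|ring].
pose f z := normal_peak 1 / Num.sqrt M *
  ((1 - z / (2 * M)) * expR (- (bend M z) ^+ 2 / (2 * M))).
apply: (@ler_of_ge0_derive _ D (fun z => (1 + y) * f (z + 2) - (1 - y) * f z)).
- by rewrite lerDl.
- move=> z _; have d1 := is_derive_bent_cdf z M0.
  have d2 := is_derive_bent_cdf (z + 2) M0.
  have d3 : is_derive z 1 (fun z : R => z + 2) 1.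
    by apply: is_derive_eq; rewrite addr0.
  have d4 : is_derive z 1 (bent_cdf M \o (fun z => z + 2)) (f (z + 2) * 1).
    exact: is_derive1_comp.
  apply: (is_derive_eq (is_deriveB _ _)).
  by rewrite /GRing.scale/= mulr1.
move=> z; rewrite in_itv/= => /andP[kz zk].
have kzk : M * y - 1 <= z <= M * y + 1 by rewrite -kE kz/=; move: zk; lra.
have := bend_density_ratio M2 ly y1 kzk.
rewrite -subr_ge0 => H; rewrite /f; set c := normal_peak 1 / _.
have c0 : 0 <= c by rewrite divr_ge0 ?sqrtr_ge0 ?normal_peak_ge0.
by have := mulr_ge0 c0 H; congr (_ <= _); ring.
Qed.

(** At every [x <= a] the density at [x + b] is at least [expR (7 / 5) >= 4]
    times the density at [x], hence [Phi (x + b) - 4 * Phi x] is nondecreasing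
    on the left of [a]; it tends to 0 at -oo. *)
Lemma Phi_tail_shift (a b : R) : 0 < b ->
  b ^+ 2 + 2 * a * b <= - (14 / 5) -> 4 * Phi a <= Phi (a + b).
Proof.
move=> b0 ab; rewrite leNgt; apply/negP => lt_ab.
pose D (z : R) := Phi (z + b) - 4 * Phi z.
have D_homo z : z <= a -> D z <= D a.
  move=> za; pose f (z : R) := normal_peak (1 : R) * expR (- z ^+ 2 / 2).
  apply: (@ler_of_ge0_derive _ D (fun z => f (z + b) - 4 * f z)) => // x.
    move=> _; have d1 := Phi_derive x; have d2 := Phi_derive (x + b).
    have d3 : is_derive x 1 (fun z : R => z + b) 1.
      by apply: is_derive_eq; rewrite addr0.
    have d4 : is_derive x 1 (@Phi R \o (fun z => z + b)) (f (x + b) * 1).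
      exact: is_derive1_comp.
    apply: (is_derive_eq (is_deriveB _ _)).
    by rewrite /GRing.scale/= mulr1.
  rewrite in_itv/= => /andP[_ xa].
  rewrite subr_ge0 /f mulrA [4 * _]mulrC -mulrA ler_wpM2l ?normal_peak_ge0//.
  apply: (@le_trans _ _ (expR (7 / 5) * expR (- x ^+ 2 / 2))).
    by rewrite ler_wpM2r ?expR_ge0 ?expR_ge4.
  rewrite -expRD ler_expR.
  have : x * b <= a * b by rewrite ler_wpM2r// ltW.
  by nra.
(* A point z left of a where 4 * Phi z is below the supposed deficit at a. *)
pose c := (4 * Phi a - Phi (a + b)) / 4.
have c0 : 0 < c by rewrite /c divr_gt0// subr_gt0.
have c1 : c < 1.
  by rewrite /c; have := Phi_lt1 a; have := Phi_gt0 (a + b); lra.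
have [|x xc] := @Phi_onto R c; first by rewrite c0.
pose z := Num.min x a - 1.
have zc : Phi z < c.
  rewrite -xc ltr_Phi /z ltrBlDr (@le_lt_trans _ _ x) ?ge_min ?lexx//.
  by rewrite ltrDl.
have za : z <= a.
  rewrite /z lerBlDr (@le_trans _ _ a) ?ge_min ?lexx ?orbT//.
  by rewrite lerDl.
have := D_homo z za; rewrite /D; have := Phi_gt0 (z + b).
by move: zc; rewrite /c; lra.
Qed.

(** At the left end [k + 1] is about [- M / 2] and the ratio of consecutive
    binomial weights is at most 3. The whole normal tail left of [k + 2] still
    fits in one cell: the cut lies near [- 9/16 * M] and the next cell has
    length near 5/2, so that moving by one cell multiplies the density by about
    [expR (45 / 32)], which exceeds 4. *)
Lemma bent_cdf_left M k : 2 <= M -> - (M / 2) <= k + 1 < - (M / 2) + 2 ->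
  (M - (k + 1)) * bent_cdf M (k + 2) <=
  (M + (k + 1)) * (bent_cdf M (k + 4) - bent_cdf M (k + 2)).
Proof.
move=> M2 /andP[lk k1]; have M0 : 0 < M by lra.
suff H : 4 * bent_cdf M (k + 2) <= bent_cdf M (k + 4).
  have H0 : 0 <= bent_cdf M (k + 2) by exact/ltW/Phi_gt0.
  apply: (@le_trans _ _ ((M + (k + 1)) * (3 * bent_cdf M (k + 2)))).
    by rewrite mulrA ler_wpM2r//; lra.
  by rewrite ler_wpM2l//; lra.
pose u := k + 2; pose l := 2 - (u + 1) / M.
have -> : k + 4 = u + 2 by rewrite /u; ring.
have s0 : 0 < Num.sqrt M by rewrite sqrtr_gt0.
have -> : bent_cdf M (u + 2) =
    Phi (bend M u / Num.sqrt M + l / Num.sqrt M).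
  congr Phi; rewrite -mulrDl; congr (_ / _).
  by rewrite /bend /l; field; rewrite gt_eqF.
(* e in [1, 3) measures the offset of u from - M / 2. *)
pose e := u + M / 2.
have e1 : 1 <= e by rewrite /e /u; lra.
have e3 : e < 3 by rewrite /e /u; lra.
pose i := M^-1; have i0 : 0 < i by rewrite invr_gt0.
have iM : i * M = 1 by rewrite mulVf// gt_eqF.
have i2 : i <= 2^-1 by rewrite lef_pV2 ?posrE.
have lE : l = 5 / 2 - (e + 1) * i.
  by rewrite /l /e /i; field; rewrite gt_eqF.
have uE : - bend M u = 9 / 16 * M + 16 - 5 / 4 * e + e ^+ 2 * i / 4.
  by rewrite /bend /e /i; field; rewrite gt_eqF.
have l1 : 5 / 2 - 4 * i <= l by rewrite lE; nra.
have l2 : l <= 5 / 2 by rewrite lE; nra.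
have l0 : 0 < l by lra.
have u1 : 9 / 16 * M + 49 / 4 <= - bend M u.
  have : 0 <= e ^+ 2 * i / 4 by rewrite divr_ge0// mulr_ge0 ?sqr_ge0// ltW.
  by rewrite uE; lra.
apply: Phi_tail_shift; first by rewrite divr_gt0.
rewrite !expr_div_n sqr_sqrtr ?(ltW M0)//.
have -> : 2 * (bend M u / Num.sqrt M) * (l / Num.sqrt M) = 2 * bend M u * l / M.
  set v := bend M u; rewrite -[X in _ = _ / X](@sqr_sqrtr _ M) ?ltW//.
  by field; rewrite gt_eqF.
rewrite -mulrDl ler_pdivrMr//.
have h1 : (9 / 8 * M + 22) * l <= - (l ^+ 2 + 2 * bend M u * l).
  have -> : - (l ^+ 2 + 2 * bend M u * l) = (2 * - bend M u - l) * l by ring.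
  by rewrite ler_wpM2r ?(ltW l0)//; lra.
have h2 : (9 / 8 * M + 22) * (5 / 2 - 4 * i) <= (9 / 8 * M + 22) * l.
  by rewrite ler_wpM2l//; lra.
have h3 : (9 / 8 * M + 22) * (5 / 2 - 4 * i) =
    45 / 16 * M + 55 - 9 / 2 * (i * M) - 88 * i by field.
by move: h1 h2; rewrite h3 iM; lra.
Qed.

End bent_cdf.

(** * Binomial versus normal distribution functions *)

(** Monotone likelihood ratio implies stochastic ordering. Cross-multiplied,
    the ratio condition says [q i * p j <= p i * q j] for [i <= j]; summing over
    [i < J <= j] gives [A * (1 - B) <= B * (1 - A)] for the two partial sums.
    Only ratios of consecutive terms are compared, so no normalizing constant
    has to be estimated. *)
Lemma ler_partial_sum_of_mlr (R : realFieldType) (m : nat) (p q : nat -> R) :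
  (forall i, (i <= m)%N -> 0 < p i) ->
  \sum_(0 <= i < m.+1) p i = 1 -> \sum_(0 <= i < m.+1) q i = 1 ->
  (forall i, (i < m)%N -> p i.+1 * q i <= p i * q i.+1) ->
  forall J, (J <= m.+1)%N ->
  \sum_(0 <= i < J) q i <= \sum_(0 <= i < J) p i.
Proof.
move=> p0 p1 q1 pq J Jm.
have mono i j : (i <= j)%N -> (j <= m)%N -> q i * p j <= p i * q j.
  elim: j => [|j IHj].
    by rewrite leqn0 => /eqP -> _; rewrite mulrC.
  rewrite leq_eqVlt => /orP[/eqP <- _|]; first by rewrite mulrC.
  rewrite ltnS => ij jm; have {}IHj := IHj ij (ltnW jm).
  rewrite -(ler_pM2r (p0 j (ltnW jm))).
  rewrite (_ : q i * p j.+1 * p j = p j.+1 * (q i * p j)); last by ring.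
  apply: (@le_trans _ _ (p j.+1 * (p i * q j))).
    by rewrite ler_wpM2l// ltW// p0.
  rewrite (_ : p j.+1 * (p i * q j) = p i * (p j.+1 * q j)); last by ring.
  rewrite (_ : p i * q j.+1 * p j = p i * (p j * q j.+1)); last by ring.
  by rewrite ler_wpM2l ?pq// ltW// p0// (leq_trans ij)// ltnW.
set A := \sum_(0 <= i < J) q i; set B := \sum_(0 <= i < J) p i.
have cross : A * \sum_(J <= j < m.+1) p j <= B * \sum_(J <= j < m.+1) q j.
  rewrite !mulr_suml ler_sum_nat// => i /andP[_ iJ].
  rewrite !mulr_sumr ler_sum_nat// => j /andP[Jj jm].
  by apply: mono; [exact: leq_trans (ltnW iJ) Jj|].
move: p1 q1; rewrite (big_cat_nat (leq0n J) Jm)//=.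
rewrite (big_cat_nat (leq0n J) Jm)//= -/A -/B => p1 q1.
have pE : \sum_(J <= j < m.+1) p j = 1 - B by lra.
have qE : \sum_(J <= j < m.+1) q j = 1 - A by lra.
by move: cross; rewrite pE qE; lra.
Qed.

Section binomial_quantiles.
Context {R : realType}.
Implicit Types (m i J : nat) (w : R).

Definition bin_mass m i : R := 'C(m, i)%:R / 2 ^+ m.

Definition bin_cdf m J : R := \sum_(0 <= i < J) bin_mass m i.

Lemma bin_mass_gt0 m i : (i <= m)%N -> 0 < bin_mass m i.
Proof. by move=> im; rewrite divr_gt0 ?exprn_gt0// ltr0n bin_gt0. Qed.

Lemma bin_mass_ge0 m i : 0 <= bin_mass m i.
Proof. by rewrite divr_ge0 ?exprn_ge0. Qed.

Lemma bin_cdf_full m : bin_cdf m m.+1 = 1.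
Proof.
rewrite /bin_cdf -mulr_suml big_mkord.
have := exprDn (1 : R) 1 m; rewrite -mulr2n => ->.
rewrite [X in _ / X](eq_bigr (fun i : 'I_m.+1 => 'C(m, i)%:R)); last first.
  by move=> i _; rewrite !expr1n mulr1.
rewrite divff// -natr_sum pnatr_eq0 -lt0n.
by rewrite big_ord_recl /= bin0.
Qed.

Lemma bin_cdfN m J : (J <= m.+1)%N ->
  bin_cdf m (m.+1 - J) = 1 - bin_cdf m J.
Proof.
move=> Jm; rewrite -(bin_cdf_full m) /bin_cdf.
rewrite [X in X - _](big_cat_nat (leq0n J) Jm)//=.
rewrite addrAC subrr add0r big_nat_rev/= add0n.
rewrite [RHS](_ : _ = \sum_(0 + J <= i < m.+1) bin_mass m i)// big_addn.
apply: eq_big_nat => i /andP[_ im].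
rewrite /bin_mass; congr (_%:R / _).
rewrite -bin_sub; last by lia.
by congr 'C(_, _); lia.
Qed.

Lemma bin_cdfS m J : bin_cdf m J.+1 = bin_cdf m J + bin_mass m J.
Proof. by rewrite /bin_cdf big_nat_recr. Qed.

Lemma bin_cdf0 m : bin_cdf m 0 = 0.
Proof. by rewrite /bin_cdf big_nil. Qed.

Let node m i : R := 2 * i%:R - m%:R.

(** The cells of the normal law are cut at the points [bend M (2 * i - m)] with
    [m %/ 4 < i <= m], all the mass left of the first cut going to the cell of
    index [m %/ 4] and the mass right of the last one to the cell of index [m].
    Binomial weights and cell masses are in monotone likelihood ratio:
    trivially below [m %/ 4], where the cells are empty, by [bent_cdf_left] at
    [m %/ 4] and by [bent_cdf_increment] above. *)
Lemma bent_cdf_le_bin_cdf m J : (m %/ 4 < J <= m)%N ->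
  bent_cdf m.+1%:R (2 * J%:R - m%:R) <= bin_cdf m J.
Proof.
move=> /andP[mJ Jm].
pose H i := bent_cdf (m.+1%:R : R) (node m i).
(* c i is the normal mass of the cells of index less than i. *)
pose c i := if (i <= m %/ 4)%N then 0 else if (i <= m)%N then H i else 1.
pose q i := c i.+1 - c i.
have sum_q K : \sum_(0 <= i < K) q i = c K.
  by rewrite telescope_sumr// /c leq0n subr0.
have H0 i : 0 <= H i by exact/ltW/Phi_gt0.
have H1 i : H i <= 1 by exact/ltW/Phi_lt1.
have m0 : (0 < m)%N by lia.
have M2 : 2 <= m.+1%:R :> R by rewrite ler_nat.
have nodeS i : node m i.+1 = node m i + 2.
  by rewrite /node -[i.+1%:R]natr1; ring.
have nodeSS i : node m i.+2 = node m i + 4 by rewrite !nodeS; ring.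
have MnB i : (i <= m)%N -> m.+1%:R - (node m i + 1) = 2 * (m - i)%:R.
  by move=> im; rewrite /node natrB// -[m.+1%:R]natr1; ring.
have MnD i : m.+1%:R + (node m i + 1) = 2 * i.+1%:R.
  by rewrite /node -[m.+1%:R]natr1 -[i.+1%:R]natr1; ring.
have lo i : (m %/ 4 <= i)%N -> - (m.+1%:R / 2) <= node m i + 1.
  move=> mi; have : (m <= 4 * i + 3)%N by lia.
  by rewrite -(ler_nat R) natrD natrM /node -[m.+1%:R]natr1; lra.
(* The binomial ratio is (m - i) / (i + 1). *)
have key i : (i < m)%N -> (m - i)%:R * q i <= i.+1%:R * q i.+1.
  move=> im; rewrite -(ler_pM2l (ltr0Sn R 1)) !mulrA -MnB 1?ltnW// -MnD /q.
  have MD0 : 0 <= m.+1%:R + (node m i + 1) by rewrite MnD mulr_ge0.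
  have c2 : (m %/ 4 <= i)%N -> H i.+2 <= c i.+2.
    rewrite /c => mi; case: ifPn => [|_]; first by lia.
    by case: ifPn.
  have c1 : (m %/ 4 <= i)%N -> c i.+1 = H i.+1.
    by rewrite /c => mi; rewrite im ifF//; apply/negbTE; lia.
  have [ilt|] := ltnP i (m %/ 4).
    have -> : c i = 0 by rewrite /c ltnW.
    have -> : c i.+1 = 0 by rewrite /c ilt.
    rewrite subrr mulr0 mulr_ge0// subr0 /c.
    by case: ifP => // _; case: ifP.
  rewrite leq_eqVlt => /orP[/eqP iE|igt]; last first.
    have -> : c i = H i by rewrite /c leqNgt igt/= ltnW.
    rewrite c1 1?ltnW//.
    apply: (@le_trans _ _
        ((m.+1%:R + (node m i + 1)) * (H i.+2 - H i.+1))); last first.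
      by rewrite ler_wpM2l// lerD2r c2// ltnW.
    rewrite /H nodeSS nodeS; apply: bent_cdf_increment => //.
    rewrite lo 1?ltnW//=.
    move: im; rewrite -(ler_nat R) /node.
    by rewrite -[m.+1%:R]natr1 -[i.+1%:R]natr1; lra.
  have mi : (m %/ 4 <= i)%N by rewrite iE.
  have -> : c i = 0 by rewrite /c -iE leqnn.
  rewrite c1// subr0.
  apply: (@le_trans _ _
      ((m.+1%:R + (node m i + 1)) * (H i.+2 - H i.+1))); last first.
    by rewrite ler_wpM2l// lerD2r c2.
  rewrite /H nodeSS nodeS; apply: bent_cdf_left => //.
  rewrite lo//=.
  have : (4 * i < m + 1)%N by lia.
  by rewrite -(ltr_nat R) natrM natrD /node -[m.+1%:R]natr1; lra.
have cJ : c J = H J by rewrite /c leqNgt mJ/= Jm.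
rewrite -[leLHS]/(H J) -cJ -sum_q.
apply: (@ler_partial_sum_of_mlr R m) => //.
- by move=> i im; exact: bin_mass_gt0.
- exact: bin_cdf_full.
- rewrite sum_q /c ltnn ifF//; apply/negbTE; lia.
- move=> i im; have kq := key i im.
  have i1 : (0 : R) < i.+1%:R by rewrite ltr0n.
  rewrite /bin_mass -(ler_pM2l i1).
  have binE : i.+1%:R * 'C(m, i.+1)%:R = 'C(m, i)%:R * (m - i)%:R :> R.
    by rewrite -!natrM mul_bin_left mulnC.
  rewrite [leLHS](_ : _ =
      'C(m, i)%:R / 2 ^+ m * ((m - i)%:R * q i)); last first.
    by rewrite !mulrA binE; ring.
  rewrite [leRHS](_ : _ =
      'C(m, i)%:R / 2 ^+ m * (i.+1%:R * q i.+1)); last by ring.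
  by rewrite ler_wpM2l// ?bin_mass_ge0.
- exact: leqW.
Qed.

End binomial_quantiles.

(** * The gap of the quantile coupling *)

Section quantile_coupling.
Context {R : realType}.
Implicit Types (m i j : nat) (u w M X : R).

(** The generalized inverse of [bin_cdf m], written as a count of thresholds so
    that it is visibly monotone in [u]. *)
Definition bin_quantile m u : nat :=
  (\sum_(1 <= j < m.+1) (bin_cdf m j < u)%R)%N.

Lemma bin_cdf_homo m : {homo @bin_cdf R m : i j / (i <= j)%N >-> i <= j}.
Proof.
move=> i j ij; rewrite /bin_cdf [leRHS](big_cat_nat (leq0n i) ij)//=.
by rewrite lerDl sumr_ge0// => k _; exact: bin_mass_ge0.
Qed.

Lemma bin_quantileE m u j : (j <= m)%N ->
  bin_cdf m j < u <= bin_cdf m j.+1 -> bin_quantile m u = j.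
Proof.
move=> jm /andP[ju uj]; rewrite /bin_quantile.
rewrite (@big_cat_nat _ _ _ j.+1)//=.
rewrite [X in (X + _)%N](_ : _ = (\sum_(1 <= i < j.+1) 1)%N); last first.
  apply: eq_big_nat => i /andP[_ ij]; rewrite (le_lt_trans _ ju)//.
  exact: bin_cdf_homo.
rewrite [X in (_ + X)%N]big1_seq ?addn0; last first.
  move=> i /andP[_]; rewrite mem_index_iota => /andP[ji _].
  by rewrite ltNge (le_trans uj)// bin_cdf_homo.
by rewrite sum_nat_const_nat muln1 subn1.
Qed.

Lemma bin_quantileP m u : 0 < u <= 1 ->
  (bin_quantile m u <= m)%N /\
  bin_cdf m (bin_quantile m u) < u <= bin_cdf m (bin_quantile m u).+1.
Proof.
move=> /andP[u0 u1].
have [j jm ju] : exists2 j, (j <= m)%N & bin_cdf m j < u <= bin_cdf m j.+1.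
  have : exists j, (j <= m)%N && (u <= bin_cdf m j.+1).
    by exists m; rewrite leqnn bin_cdf_full.
  move=> ex; have [j /andP[jm uj] jmin] := ex_minnP ex; exists j => //.
  rewrite uj andbT ltNge; apply/negP.
  case: j jm uj jmin => [|j] jm uj jmin; first by rewrite bin_cdf0 leNgt u0.
  move=> uj'; have := jmin j; rewrite (ltnW jm) uj' => /(_ isT).
  by rewrite ltnn.
by rewrite (bin_quantileE jm ju).
Qed.

(** When the walk is at distance of order [M] from 0, so is [Num.sqrt M * w]:
    then [M = O(1 + w ^+ 2)] and the triangle inequality suffices. *)
Lemma quantile_gap_extreme M X w : 1 <= M -> X <= - ((M - 1) / 2) -> - M <= X ->
  Num.sqrt M * w <= X + 16 + X ^+ 2 / (4 * M) ->
  `|X - Num.sqrt M * w| <= 300 + 60 * w ^+ 2.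
Proof.
move=> M1 XM MX; set Z : R := Num.sqrt M * w => ZX.
have M0 : 0 < M by lra.
have X0 : X <= 0 by lra.
have X2 : X ^+ 2 / (4 * M) <= - X / 4.
  rewrite ler_pdivrMr ?mulr_gt0//.
  have -> : - X / 4 * (4 * M) = - X * M by field.
  by rewrite expr2 -mulrNN ler_wpM2l ?oppr_ge0//; lra.
have ZE : Z ^+ 2 = M * w ^+ 2 by rewrite /Z exprMn sqr_sqrtr// ltW.
have nX : - X <= 4 / 3 * (`|Z| + 16).
  by have := ler_norm (- Z); rewrite normrN; lra.
have MZ : M <= 3 * `|Z| + 44 by have := normr_ge0 Z; lra.
have Zn : `|Z| ^+ 2 = M * w ^+ 2 by rewrite real_normK ?num_real.
have Z1 : `|Z| <= 25 * w ^+ 2 + 22.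
  have w2 := sqr_ge0 w; have z0 := normr_ge0 Z.
  have h1 : `|Z| * M <= 3 * (M * w ^+ 2) + 44 * `|Z|.
    by rewrite -Zn; have := ler_wpM2l z0 MZ; lra.
  have h2 : 2 * `|Z| <= M * (1 + w ^+ 2).
    have := sqr_ge0 (`|Z| - M); rewrite sqrrB Zn => h.
    have h' : M * w ^+ 2 <= M * (M * w ^+ 2).
      by rewrite ler_peMl// mulr_ge0// (ltW M0).
    by rewrite -(ler_pM2r M0); lra.
  rewrite -(ler_pM2r M0); nra.
apply: (le_trans (ler_normB _ _)); rewrite (ler0_norm X0).
by have := sqr_ge0 w; lra.
Qed.

(** [X ^+ 2 / (4 * M)] is at most [`|X| / 4], which forces
    [`|X| <= 4/3 * (Num.sqrt M * `|w| + 16)]; hence [X ^+ 2 / M] is itself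
    [O(1 + w ^+ 2)]. *)
Lemma quantile_gap_bulk M X w : 1 <= M -> `|X| <= M ->
  X - 16 - X ^+ 2 / (4 * M) <= Num.sqrt M * w <= X + 16 + X ^+ 2 / (4 * M) ->
  `|X - Num.sqrt M * w| <= 300 + 60 * w ^+ 2.
Proof.
move=> M1 XM; set Z : R := Num.sqrt M * w => /andP[ZX XZ].
have M0 : 0 < M by lra.
have d : `|X - Z| <= 16 + X ^+ 2 / (4 * M) by rewrite ler_norml; lra.
have X2 : X ^+ 2 / (4 * M) <= `|X| / 4.
  rewrite ler_pdivrMr ?mulr_gt0//.
  have -> : `|X| / 4 * (4 * M) = `|X| * M by field.
  by rewrite -(@real_normK _ X) ?num_real// expr2 ler_wpM2l.
have nX : `|X| <= 4 / 3 * (`|Z| + 16).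
  have : `|X| <= `|X - Z| + `|Z| by rewrite -{1}(subrK Z X) ler_normD.
  by lra.
have Zn : `|Z| ^+ 2 = M * w ^+ 2.
  by rewrite real_normK ?num_real// exprMn sqr_sqrtr// ltW.
have X3 : X ^+ 2 / (4 * M) <= w ^+ 2 + 256.
  rewrite ler_pdivrMr ?mulr_gt0// -(@real_normK _ X) ?num_real//.
  have : `|X| ^+ 2 <= (4 / 3 * (`|Z| + 16)) ^+ 2.
    by rewrite lerXn2r ?nnegrE// (le_trans _ nX).
  have := sqr_ge0 (`|Z| - 16); have := sqr_ge0 w; nra.
by have := sqr_ge0 w; lra.
Qed.

(** A Tusnady-type inequality: a standard normal value [w] and the binomial
    quantile of [Phi w] differ, after scaling, by [O(1 + w ^+ 2)] uniformly in
    the number of steps. [bent_cdf_le_bin_cdf] bounds [w] from below; applied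
    to the reflected walk, at index [m - j], it bounds [w] from above. At least
    one of the two bounds is available unless [m = 0], and only one of them in
    the two extreme quarters of the indices. *)
Lemma quantile_gap m j w : (j <= m)%N ->
  bin_cdf m j < Phi w <= bin_cdf m j.+1 ->
  `|(2 * j%:R - m%:R) - Num.sqrt m.+1%:R * w| <= 300 + 60 * w ^+ 2.
Proof.
move=> jm /andP[jw wj].
set M : R := m.+1%:R; set X : R := 2 * j%:R - m%:R; set Z : R := Num.sqrt M * w.
have s0 : 0 < Num.sqrt M by rewrite sqrtr_gt0 ltr0n.
have M1 : 1 <= M by rewrite ler1n.
have jm' : j%:R <= m%:R :> R by rewrite ler_nat.
have j0 : 0 <= j%:R :> R by [].
have ME : M = m%:R + 1 by rewrite natr1.
have XM : `|X| <= M by rewrite ler_norml /X; lra.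
have lower : (m %/ 4 < j)%N -> X - 16 - X ^+ 2 / (4 * M) <= Z.
  move=> mj; have : (m %/ 4 < j <= m)%N by rewrite mj.
  move=> /(@bent_cdf_le_bin_cdf R) /le_lt_trans/(_ jw).
  by rewrite /bent_cdf ltr_Phi ltr_pdivrMr// => /ltW; rewrite [w * _]mulrC.
have upper : (j < m - m %/ 4)%N -> Z <= X + 16 + X ^+ 2 / (4 * M).
  move=> mj; have : (m %/ 4 < m - j <= m)%N by lia.
  move=> /(@bent_cdf_le_bin_cdf R).
  have -> : 2 * (m - j)%:R - m%:R = - X by rewrite natrB// /X; ring.
  rewrite -subSS bin_cdfN// => h.
  have : bent_cdf M (- X) <= Phi (- w).
    by rewrite PhiN (le_trans h)// lerD2l lerN2.
  rewrite /bent_cdf ler_Phi ler_pdivrMr// /bend sqrrN mulNr [w * _]mulrC -/Z.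
  by move: (X ^+ 2 / (4 * M)) => V; clear; clearbody X Z => ?; lra.
have [hj|hj] := leqP j (m %/ 4).
  have [hj'|hj'] := ltnP j (m - m %/ 4).
    apply: quantile_gap_extreme => //; last exact: upper.
      have : (4 * j <= m)%N by lia.
      by rewrite -(ler_nat R) natrM /X; lra.
    by move: XM; rewrite ler_norml => /andP[].
  have m0 : m = 0 by lia.
  have j00 : j = 0 by lia.
  rewrite /X /Z /M j00 m0 sqrtr1 mulr0 subr0 sub0r mul1r normrN.
  have := sqr_ge0 (`|w| - 1); rewrite sqrrB1 real_normK ?num_real//.
  by have := sqr_ge0 w; lra.
have [hj'|hj'] := ltnP j (m - m %/ 4).
  by apply: quantile_gap_bulk => //; rewrite lower//= upper.
have -> : `|X - Z| = `|- X - Num.sqrt M * - w|.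
  by rewrite mulrN -/Z -opprD normrN.
rewrite -[w ^+ 2]sqrrN.
apply: quantile_gap_extreme => //.
- have : (3 * m <= 4 * j)%N by lia.
  by rewrite -(ler_nat R) !natrM /X; lra.
- by move: XM; rewrite ler_norml lerN2 => /andP[].
- have := lower hj; rewrite mulrN sqrrN -/Z.
  by move: (X ^+ 2 / (4 * M)) => V; clear; clearbody X Z => ?; lra.
Qed.

End quantile_coupling.

(** * Gaussian moments and atomic laws *)

Section normal_integral.
Context {R : realType}.
Local Notation mu := (@lebesgue_measure R).

(** The Radon-Nikodym derivative of the normal law with respect to Lebesgue
    measure is its density almost everywhere, since both have the same
    integrals over measurable sets. *)
Lemma ge0_integral_normal_prob (s : R) (f : R -> \bar R) :
  measurable_fun setT f -> (forall x, 0 <= f x)%E ->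
  (\int[normal_prob 0 s]_x f x = \int[mu]_x (f x * (normal_pdf 0 s x)%:E))%E.
Proof.
move=> mf f0.
have mpdf : measurable_fun [set: R] (EFin \o normal_pdf (0 : R) s).
  by apply/measurable_EFinP; exact: measurable_normal_pdf.
have dom := normal_prob_dominates (0 : R) s.
rewrite -(Radon_Nikodym_SigmaFinite.change_of_variables dom f0 measurableT mf).
have RN := Radon_Nikodym_SigmaFinite.f_integrable dom.
apply: ae_eq_integral => //.
- by apply: emeasurable_funM => //; exact: measurable_int RN.
- by apply: emeasurable_funM.
- apply: ae_eqe_mul2l; apply: integral_ae_eq => //.
  by move=> E _ mE; rewrite -Radon_Nikodym_SigmaFinite.f_integral.
Qed.

(** The integrand times the density of deviation [s] is [Num.sqrt 2] times the
    density of deviation [s * Num.sqrt 2]. *)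
Lemma normal_exp_square_moment (s : R) : 0 < s ->
  (\int[normal_prob 0 s]_x (expR ((x / s) ^+ 2 / 4))%:E = (Num.sqrt 2)%:E)%E.
Proof.
move=> s0; rewrite ge0_integral_normal_prob; last 2 first.
- apply/measurable_EFinP; apply: measurableT_comp => //.
  apply: measurable_funM => //; apply: measurable_funX.
  exact: measurable_funM.
- by move=> x; rewrite lee_fin expR_ge0.
have t0 : 0 < Num.sqrt 2 :> R by rewrite sqrtr_gt0.
have st0 : 0 < s * Num.sqrt 2 by rewrite mulr_gt0.
transitivity (\int[mu]_x
    ((Num.sqrt 2)%:E * (normal_pdf 0 (s * Num.sqrt 2) x)%:E))%E.
  apply: eq_integral => x _; rewrite -!EFinM; congr EFin.
  rewrite !normal_pdfE ?gt_eqF// /normal_fun subr0 /normal_peak.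
  have -> : (s * Num.sqrt 2) ^+ 2 = s ^+ 2 * 2 by rewrite exprMn sqr_sqrtr.
  have -> : Num.sqrt (s ^+ 2 * 2 * pi *+ 2) =
      Num.sqrt (s ^+ 2 * pi *+ 2) * Num.sqrt 2.
    rewrite -sqrtrM; first by congr Num.sqrt; ring.
    by rewrite mulrn_wge0// mulr_ge0 ?sqr_ge0 ?pi_ge0.
  have p0 : Num.sqrt (s ^+ 2 * pi *+ 2) != 0.
    by rewrite gt_eqF// sqrtr_gt0 mulrn_wgt0// mulr_gt0 ?pi_gt0// exprn_gt0.
  have -> : expR (- x ^+ 2 / (s ^+ 2 * 2 *+ 2)) =
      expR ((x / s) ^+ 2 / 4) * expR (- x ^+ 2 / (s ^+ 2 *+ 2)).
    by rewrite -expRD; congr expR; field; rewrite gt_eqF.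
  by field; rewrite p0 gt_eqF.
rewrite ge0_integralZl//=; last 2 first.
- by apply/measurable_EFinP; exact: measurable_normal_pdf.
- by move=> x _; rewrite lee_fin normal_pdf_ge0.
by rewrite integral_normal_pdf mule1.
Qed.

End normal_integral.

(** Lower bounds on the atoms determine the law when they add up to 1: they
    give a lower bound for the probability of [A] and of its complement, and
    the two bounds add up to 1. *)
Lemma law_of_atoms d (Omega : measurableType d) (R : realType)
    (P : probability Omega R) (X : {RV P >-> R}) (m : nat) (x p : nat -> R) :
  {in [pred i | (i <= m)%N] &, injective x} ->
  (forall i, (i <= m)%N -> ((p i)%:E <= P (X @^-1` [set x i]))%E) ->
  \sum_(0 <= i < m.+1) p i = 1 ->
  forall A, measurable A ->
    distribution P X A = (\sum_(0 <= i < m.+1 | x i \in A) p i)%:E.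
Proof.
move=> x_inj px p1.
pose s (A : set R) n := \sum_(0 <= i < n | x i \in A) p i.
have low n (A : set R) : (n <= m.+1)%N -> measurable A ->
    ((s A n)%:E <= distribution P X A)%E.
  elim: n A => [|n IHn] A nm mA; first by rewrite /s big_nil measure_ge0.
  rewrite /s big_mkcond big_nat_recr//= -big_mkcond/=.
  case: ifPn => xnA; last by rewrite addr0; apply: IHn => //; exact: ltnW.
  have mA' : measurable (A `\ x n) by exact: measurableD.
  have := IHn (A `\ x n) (ltnW nm) mA'.
  have -> : s (A `\ x n) n = \sum_(0 <= i < n | x i \in A) p i.
    rewrite /s big_nat_cond [RHS]big_nat_cond; apply: eq_bigl => i.
    apply: andb_id2l => /andP[_ im].
    apply/idP/idP; rewrite !inE; first by case.
    move=> xiA; split => //= xin.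
    have : i = n by apply: x_inj => //; rewrite inE//; lia.
    by move=> e; move: im; rewrite e ltnn.
  move=> sA; rewrite EFinD.
  have -> : distribution P X A =
      (distribution P X (A `\ x n) + distribution P X [set x n])%E.
    rewrite -measureU//; last by rewrite setDE -setIA setICl setI0.
    by rewrite setUC setDUK// => y ->; move: xnA; rewrite inE.
  by apply: leeD => //; exact: px.
have sC (A : set R) : s A m.+1 + s (~` A) m.+1 = 1.
  rewrite -p1 [RHS](bigID (fun i => x i \in A))/=; congr (_ + _).
  by apply: eq_bigl => i; rewrite in_setC.
move=> A mA; apply/eqP; rewrite eq_le low// andbT.
have mAC : measurable (~` A) by exact: measurableC.
pose r := fine (distribution P X A).
have rE : distribution P X A = r%:E by rewrite fineK// fin_num_measure.
have h : ((s (~` A) m.+1)%:E <= 1 - r%:E)%E.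
  rewrite -rE; apply: (le_trans (low _ _ (leqnn _) mAC)).
  by rewrite (probability_setC (distribution P X) mA).
rewrite rE lee_fin -/(s A m.+1); move: h; rewrite -EFinD lee_fin.
by have := sC A; lra.
Qed.

(** * Sums of independent signs *)

Section sum_of_signs.
Context d (Omega : measurableType d) (R : realType) (P : probability Omega R).
Variable xi : nat -> {RV P >-> R}.
Hypothesis xi_iid : iid_signs P xi.

Let cyl (K : seq nat) (e : nat -> R) : set Omega :=
  \bigcap_(k in [set` K]) xi k @^-1` [set e k].

Let level (J : seq nat) (c : R) : set Omega :=
  [set w | \sum_(k <- J) xi k w = c].

Let measurable_cyl K e : measurable (cyl K e).
Proof. exact: fin_bigcap_measurable. Qed.

Let measurable_level J c : measurable (level J c).
Proof.
have mJ : measurable_fun setT (fun w => \sum_(k <- J) xi k w).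
  exact: measurable_sum.
by have := mJ measurableT [set c] (measurable_set1 c); rewrite setTI.
Qed.

Let bin_massS n j : @bin_mass R n.+1 j.+1 =
  (bin_mass n j.+1 + bin_mass n j) / 2.
Proof. by rewrite /bin_mass binS natrD exprS; field; rewrite expf_neq0. Qed.

Let bin_massS0 n : @bin_mass R n.+1 0 = bin_mass n 0 / 2.
Proof. by rewrite /bin_mass !bin0 exprS; field; rewrite expf_neq0. Qed.

(** Independence is a product rule for cylinders, so the induction carries a
    cylinder along: it removes one index from the sum and fixes its sign in the
    cylinder. The two values of that sign give disjoint events, and their
    masses add up by Pascal's rule. *)
Let sign_mass_cyl (J K : seq nat) (e : nat -> R) (j : nat) :
  uniq (J ++ K) -> (forall k, k \in J ++ K -> (1 <= k)%N) ->
  (forall k, k \in K -> e k = 1 \/ e k = -1) ->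
  ((bin_mass (size J) j / 2 ^+ size K)%:E <=
   P (level J (2 * j%:R - (size J)%:R) `&` cyl K e))%E.
Proof.
elim: J K e j => [|k J IHJ] K e j uJK ge1 esign.
  case: j => [|j]; last by rewrite /bin_mass bin_small// !mul0r.
  rewrite (_ : level _ _ = setT) ?setTI; last first.
    by apply/seteqP; split => // w _; rewrite /level/= big_nil mulr0 subr0.
  have K1 : [set` K] `<=` [set k | (1 <= k)%N] by move=> k /= kK; exact: ge1.
  rewrite /cyl xi_iid.1//.
  rewrite /bin_mass bin0 expr0 divr1 mul1r.
  rewrite (eq_big_seq (fun=> (2^-1)%:E)); last first.
    move=> k kK; have [h1 h2] := xi_iid.2 k (ge1 k kK).
    by have [->|->] := esign k kK.
  rewrite (_ : (\prod_(k <- K) _)%E = (2 ^+ size K)^-1%:E)//.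
  elim: (K) => [|k K' IHK]; first by rewrite big_nil invr1.
  by rewrite big_cons IHK -EFinM /= exprS invfM.
have uK k' : k' \in k :: K -> (1 <= k')%N.
  move=> kK; apply: ge1; rewrite mem_cat inE.
  by move: kK; rewrite inE => /orP[->//|->]; rewrite orbT.
have uJkK : uniq (J ++ k :: K).
  move: uJK; rewrite -cat1s -[k :: K]cat1s.
  by rewrite (perm_uniq (permEl (perm_catCA _ _ _))).
have ge1' k' : k' \in J ++ k :: K -> (1 <= k')%N.
  rewrite mem_cat => /orP[kJ|/uK//].
  by apply: ge1; rewrite mem_cat inE kJ orbT.
pose ek (b : R) i := if i == k then b else e i.
have ek_sign b : b = 1 \/ b = -1 ->
    forall k', k' \in k :: K -> ek b k' = 1 \/ ek b k' = -1.
  by move=> hb k'; rewrite inE /ek; case: eqP => //= _; exact: esign.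
have kK : k \notin K.
  by move: uJK => /= /andP[]; rewrite mem_cat negb_or => /andP[].
have cyl_ek b w : cyl (k :: K) (ek b) w -> xi k w = b /\ cyl K e w.
  move=> h; split.
    by have := h k; rewrite /= inE eqxx /ek eqxx; exact.
  move=> i /= iK; have := h i; rewrite /= inE iK orbT /ek.
  by case: eqP => [ik|_]; [move: kK; rewrite -ik iK|exact].
pose piece b c := level J c `&` cyl (k :: K) (ek b).
have sub_piece b c : piece b (c - b) `<=` level (k :: J) c `&` cyl K e.
  move=> w [hl /cyl_ek[hk hc]]; split => //.
  by rewrite /level/= big_cons hk hl; ring.
have mpiece b c : measurable (piece b c) by exact: measurableI.
have plus j' : ((bin_mass (size J) j' / 2 ^+ (size K).+1)%:E <=
    P (piece 1%R (2 * j'%:R - (size J)%:R)%R))%E.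
  by apply: IHJ => //; apply: ek_sign; left.
have minus j' : ((bin_mass (size J) j' / 2 ^+ (size K).+1)%:E <=
    P (piece (-1)%R (2 * j'%:R - (size J)%:R)%R))%E.
  by apply: IHJ => //; apply: ek_sign; right.
have mtarget c : measurable (level (k :: J) c `&` cyl K e).
  exact: measurableI.
case: j => [|j] /=.
  apply: (@le_trans _ _ (P (piece (-1) (2 * 0%:R - (size J)%:R)))).
    apply: le_trans (minus 0%N); rewrite lee_fin bin_massS0 exprS.
    by rewrite invfM mulrA.
  apply: le_measure; rewrite ?inE//.
  have := @sub_piece (-1) (2 * 0%:R - (size J).+1%:R).
  by congr (piece _ _ `<=` _); rewrite -natr1; ring.
apply: (@le_trans _ _ (P (piece (-1) (2 * j.+1%:R - (size J)%:R) `|`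
                          piece 1 (2 * j%:R - (size J)%:R)))).
  rewrite measureU//; last first.
    apply/seteqP; split => // w [[_ /cyl_ek[h1 _]] [_ /cyl_ek[h2 _]]].
    by move: h1; rewrite h2 => h; exfalso; lra.
  apply: le_trans (leeD (minus j.+1) (plus j)).
  rewrite -EFinD lee_fin bin_massS exprS le_eqVlt; apply/orP; left; apply/eqP.
  by field; rewrite expf_neq0.
apply: le_measure; rewrite ?inE//; first exact: measurableU.
rewrite subUset; split.
  have := @sub_piece (-1) (2 * j.+1%:R - (size J).+1%:R).
  by congr (piece _ _ `<=` _); rewrite -[(size J).+1%:R]natr1; ring.
have := @sub_piece 1 (2 * j.+1%:R - (size J).+1%:R).
congr (piece _ _ `<=` _).
by rewrite -[(size J).+1%:R]natr1 -[j.+1%:R]natr1; ring.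
Qed.

Lemma sign_sum_mass (J : seq nat) (j : nat) :
  uniq J -> (forall k, k \in J -> (1 <= k)%N) ->
  ((bin_mass (size J) j)%:E <=
   P [set w | (\sum_(k <- J) xi k w = 2 * j%:R - (size J)%:R)%R])%E.
Proof.
move=> uJ J1; have := @sign_mass_cyl J [::] (fun=> 1) j.
rewrite cats0 => /(_ uJ J1); rewrite expr0 divr1 => /(_ _)/le_trans; apply.
  by move=> k; rewrite in_nil.
apply: le_measure; rewrite ?inE; last by move=> w [].
  exact: measurableI.
exact: measurable_level.
Qed.

End sum_of_signs.

(** * The quantile coupling of a Gaussian variable *)

Section normal_transform.
Context d (Omega : measurableType d) (R : realType) (P : probability Omega R).
Variables (W : {RV P >-> R}) (sigma : R).
Hypothesis sigma0 : 0 < sigma.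
Hypothesis W_law : has_law P W (normal_prob 0 sigma).

Lemma measurable_Phi : measurable_fun setT (@Phi R).
Proof. by apply: nondecreasing_measurable => // a b; rewrite ler_Phi. Qed.

Let U w := Phi (W w / sigma).

Let mW : measurable_fun setT (fun w => W w / sigma).
Proof. exact: measurable_funM. Qed.

Let mU : measurable_fun setT U.
Proof. exact: measurableT_comp measurable_Phi mW. Qed.

Let measurable_U_le p : measurable [set w | U w <= p].
Proof.
have := mU measurableT (measurable_itv `]-oo, p]); rewrite setTI.
by congr measurable; apply/seteqP; split => w /=; rewrite in_itv.
Qed.

Lemma Phi_normal_uniform (p : R) : 0 <= p <= 1 ->
  P [set w | Phi (W w / sigma) <= p] = p%:E.
Proof.
move=> /andP[p0 p1]; have [pE|p0'] := eqVneq p 0.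
  rewrite (_ : [set _ | _] = set0) ?measure0 ?pE//.
  by apply/seteqP; split => w //=; rewrite leNgt Phi_gt0.
have [pE|p1'] := eqVneq p 1.
  rewrite (_ : [set _ | _] = setT) ?probability_setT ?pE//.
  by apply/seteqP; split => w //= _; rewrite ltW// Phi_lt1.
have [|a aE] := @Phi_onto R p; first by rewrite !lt_neqAle eq_sym p0' p1' p0.
have := W_law (measurable_itv `]-oo, sigma * a]).
rewrite normal_cdfE normal_cdf_scale// aE => <-.
congr (P _); apply/seteqP; split => w /=; rewrite in_itv/= -aE ler_Phi.
  by rewrite ler_pdivrMr// mulrC.
by rewrite ler_pdivrMr// mulrC.
Qed.

(** [U = Phi (W / sigma)] is uniform, so its binomial quantile takes the value
    [j] when [U] falls between [bin_cdf m j] and [bin_cdf m j.+1], which has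
    probability [bin_mass m j]. *)
Lemma quantile_coupling_exists (m : nat) (x r : R) : 0 < r ->
  exists X : {RV P >-> R},
    (forall A, measurable A -> distribution P X A =
      (\sum_(0 <= j < m.+1 | (x + r * (2 * j%:R - m%:R)) \in A)
         bin_mass m j)%:E) /\
    forall w, `|(X w - x) / r - Num.sqrt m.+1%:R * (W w / sigma)| <=
      300 + 60 * (W w / sigma) ^+ 2.
Proof.
move=> r0.
pose q (y : R) : R := (bin_quantile m (Phi (y / sigma)))%:R.
have mq : measurable_fun setT q.
  apply: nondecreasing_measurable => // a b ab; rewrite /q ler_nat.
  apply: leq_sum => j _; case: ltP => // ja.
  rewrite (lt_le_trans ja)// ler_Phi ler_pM2r ?invr_gt0//.
pose f w := x + r * (2 * q (W w) - m%:R).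
have mf : measurable_fun setT f.
  apply: measurable_funD => //; apply: measurable_funM => //.
  apply: measurable_funB => //; apply: measurable_funM => //.
  exact: measurableT_comp.
pose X : {RV P >-> R} := HB.pack f (isMeasurableFun.Build _ _ _ _ f mf).
have U01 w : 0 < U w <= 1 by rewrite Phi_gt0 ltW// Phi_lt1.
exists X; split; last first.
  move=> w; have [jm ju] := bin_quantileP m (U01 w).
  have -> : (X w - x) / r = 2 * (bin_quantile m (U w))%:R - m%:R.
    by rewrite /= /f/q -/(U w); field; rewrite gt_eqF.
  exact: quantile_gap.
have F01 j : (j <= m.+1)%N -> 0 <= @bin_cdf R m j <= 1.
  move=> jm; rewrite -(bin_cdf_full m) -{1}(bin_cdf0 m).
  by rewrite !bin_cdf_homo.
apply: law_of_atoms.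
- move=> i j _ _ /addrI /(mulfI (lt0r_neq0 r0)) /addIr ij.
  by apply/eqP; rewrite -(eqr_nat R); apply/eqP; lra.
- move=> j jm.
  pose E := [set w | U w <= bin_cdf m j.+1] `\` [set w | U w <= bin_cdf m j].
  have mE : measurable E by exact: measurableD.
  apply: (@le_trans _ _ (P E)); last first.
    apply: le_measure; rewrite ?inE//.
    move=> w [/= ju /negP]; rewrite -ltNge => uj.
    by rewrite /f/q -/(U w) (@bin_quantileE _ _ _ j)// uj.
  pose A := [set w | U w <= bin_cdf m j].
  have AE : [set w | U w <= bin_cdf m j.+1] = A `|` E.
    by rewrite setDUK// => w /= /le_trans; apply; exact: bin_cdf_homo.
  have split : ((bin_cdf m j.+1)%:E = P A + P E)%E.
    rewrite -(Phi_normal_uniform (F01 j.+1 jm)) -/U AE measureU//.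
      exact: measurable_U_le.
    by rewrite /E setDE setIC -setIA setICl setI0.
  have PA : P A = (bin_cdf m j)%:E.
    exact: Phi_normal_uniform (F01 j (leqW jm)).
  have PE : P E = (fine (P E))%:E by rewrite fineK// fin_num_measure.
  move: split; rewrite PA PE bin_cdfS -EFinD lee_fin => -[/addrI ->].
  exact: lexx.
- exact: bin_cdf_full.
Qed.

(** E exp(1/4 + Z^2/4) = exp(1/4) * sqrt 2 <= 2 for a standard normal Z. *)
Lemma orlicz_norm_le_normal (D : {RV P >-> R}) (a : R) : 0 < a ->
  (forall w, `|D w / a| <= 1 / 4 + (W w / sigma) ^+ 2 / 4) ->
  (orlicz_norm P D <= a%:E)%E.
Proof.
move=> a0 Da; apply: ereal_inf_lbound; exists a => //; split => //.
have mD : measurable_fun setT (fun w => expR `|D w / a|).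
  apply: measurableT_comp => //; apply: measurableT_comp => //.
  exact: measurable_funM.
have mH : measurable_fun setT (fun w => expR ((W w / sigma) ^+ 2 / 4)).
  apply: measurableT_comp => //; apply: measurable_funM => //.
  exact: measurable_funX.
have mG : measurable_fun [set: measurableTypeR R]
    (fun y : R => (expR ((y / sigma) ^+ 2 / 4))%:E).
  apply/measurable_EFinP; apply: measurableT_comp => //.
  apply: measurable_funM => //; apply: measurable_funX.
  exact: measurable_funM.
have intG : (\int[P]_w (expR ((W w / sigma) ^+ 2 / 4))%:E = (Num.sqrt 2)%:E)%E.
  rewrite -(normal_exp_square_moment sigma0).
  (* normal_prob is a measure on measurableTypeR R, which has the same
     measurable sets as R. *)
  have mWR : measurable_fun setT (W : Omega -> measurableTypeR R).
    have mW0 : measurable_fun setT W by [].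
    by move=> mT Y mY; exact: (mW0 mT Y mY).
  pose W' : {RV P >-> measurableTypeR R} :=
    HB.pack (W : Omega -> measurableTypeR R)
      (isMeasurableFun.Build _ _ _ _ _ mWR).
  transitivity (\int[distribution P W']_y (expR ((y / sigma) ^+ 2 / 4))%:E)%E.
    by rewrite ge0_integral_distribution// => y; rewrite lee_fin expR_ge0.
  by apply: eq_measure_integral => A mA _; exact: W_law.
have intD : (\int[P]_w (expR `|D w / a|)%:E <= 2%:E)%E.
  apply: (@le_trans _ _ (\int[P]_w
      ((expR (1 / 4))%:E * (expR ((W w / sigma) ^+ 2 / 4))%:E)))%E.
    apply: ge0_le_integral => //.
    - exact/measurable_EFinP.
    - apply/measurable_EFinP; apply: measurable_funM => //.
    - by move=> w _; rewrite -EFinM lee_fin -expRD ler_expR.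
  rewrite ge0_integralZl//; last exact/measurable_EFinP.
  rewrite intG -EFinM lee_fin.
  have e2 : expR (1 / 4) <= Num.sqrt 2 :> R.
    rewrite -(@ger0_norm _ (expR (1 / 4))) ?expR_ge0// -sqrtr_sqr.
    rewrite ler_wsqrtr// -expRM_natl -[leRHS]invrK.
    rewrite -[leLHS]invrK -expRN lef_pV2 ?posrE ?expR_gt0//.
    by apply: le_trans (expR_ge1Dx _); lra.
  apply: (@le_trans _ _ (Num.sqrt 2 * Num.sqrt 2)).
    by rewrite ler_wpM2r ?sqrtr_ge0.
  by rewrite -expr2 sqr_sqrtr.
rewrite unlock /psi.
have int1 : (\int[P]_w 1%:E = 1)%E.
  rewrite integral_cst// -[RHS]mule1; congr (_ * _)%E.
  exact: probability_setT.
have : (\int[P]_w (expR `|D w / a|)%:E =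
    \int[P]_w (expR `|D w / a| - 1)%:E + \int[P]_w 1%:E)%E.
  rewrite -ge0_integralD//.
  - by apply: eq_integral => w _; rewrite -EFinD subrK.
  - by apply/measurable_EFinP; exact: measurable_funB.
move=> DE; move: intD; rewrite DE int1.
by rewrite -leeBrDr// -EFinB (_ : 2 - 1 = 1 :> R)//; ring.
Qed.

End normal_transform.

(** * The random walk and the Brownian motion *)

Section walk_law.
Context d (Omega : measurableType d) (R : realType) (P : probability Omega R).
Variable xi : nat -> {RV P >-> R}.
Hypothesis xi_iid : iid_signs P xi.

Lemma random_walkE (T : R) (n : nat) (t : R) w :
  random_walk P T xi n t w = Num.sqrt (T / n%:R) *
    \sum_(1 <= k < (Num.truncn (t / (T / n%:R))).+1) xi k w.
Proof.
rewrite /random_walk/= mulrC; congr (_ * _).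
exact: (big_morph (fun f : {RV P >-> R} => f w) (fun _ _ => erefl) erefl).
Qed.

(** Between times [t] and [s] the walk makes [m] steps, and [m] independent
    signs add up to [2 * j - m] with binomial probability. *)
Lemma walk_increment_law (T t x s : R) (n : nat) : 0 < T / n%:R ->
  0 <= t -> t <= s ->
  let h := T / n%:R in
  let m := (Num.truncn (s / h) - Num.truncn (t / h))%N in
  forall A, measurable A ->
  distribution P (started_at P (random_walk P T xi n) t x s) A =
  (\sum_(0 <= j < m.+1 | (x + Num.sqrt h * (2 * j%:R - m%:R)) \in A)
     bin_mass m j)%:E.
Proof.
move=> h0 t0 ts h m.
set a := Num.truncn (t / h) in m *; set b := Num.truncn (s / h) in m *.
have ab : (a <= b)%N.
  by apply: le_truncn; rewrite ler_wpM2r// invr_ge0 (ltW h0).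
have r0 : 0 < Num.sqrt h by rewrite sqrtr_gt0.
set X := started_at _ _ _ _ _.
have XE w : X w = x + Num.sqrt h * \sum_(k <- index_iota a.+1 b.+1) xi k w.
  rewrite /X /started_at/=; congr (_ + _).
  rewrite -[LHS]/(random_walk P T xi n s w - random_walk P T xi n t w).
  rewrite !random_walkE -/h -/a -/b -mulrBr; congr (_ * _).
  by rewrite (@big_cat_nat _ _ _ a.+1)//= addrAC subrr add0r.
apply: law_of_atoms.
- move=> i j _ _ /addrI /(mulfI (lt0r_neq0 r0)) /addIr ij.
  by apply/eqP; rewrite -(eqr_nat R); apply/eqP; lra.
- move=> j jm.
  have := @sign_sum_mass _ _ _ _ _ xi_iid (index_iota a.+1 b.+1) j
    (iota_uniq _ _).
  rewrite size_iota subSS -/m => /(_ _)/le_trans; apply.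
    by move=> k; rewrite mem_index_iota => /andP[/(leq_ltn_trans (leq0n a))].
  apply: le_measure; rewrite ?inE//.
  + have mS : measurable_fun setT
        (fun w => \sum_(k <- index_iota a.+1 b.+1) xi k w).
      exact: measurable_sum.
    have := mS measurableT _ (measurable_set1 (2 * j%:R - m%:R)).
    by rewrite setTI.
  + by move=> w Sw; apply: (etrans (XE w)); rewrite Sw.
- exact: bin_cdf_full.
Qed.

End walk_law.

Lemma W_psi_le d1 d2 d (Omega1 : measurableType d1) (Omega2 : measurableType d2)
    (Omega : measurableType d) (R : realType) (P1 : probability Omega1 R)
    (P2 : probability Omega2 R) (P : probability Omega R)
    (X : {RV P1 >-> R}) (Y : {RV P2 >-> R}) (X' Y' : {RV P >-> R}) :
  has_law P X' (distribution P1 X) -> has_law P Y' (distribution P2 Y) ->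
  (W_psi P1 P2 X Y <= orlicz_norm P (X' - Y')%R)%E.
Proof.
by move=> lX lY; apply: ereal_inf_lbound; exists d, Omega, P, X', Y'.
Qed.

Lemma orlicz_norm0_le d (Omega : measurableType d) (R : realType)
    (P : probability Omega R) (D : {RV P >-> R}) (a : R) : 0 < a ->
  (forall w, D w = 0) -> (orlicz_norm P D <= a%:E)%E.
Proof.
move=> a0 D0; apply: ereal_inf_lbound; exists a => //; split => //.
rewrite (_ : (fun w => _) = cst 0) ?expectation_cst//.
by apply/funext => w; rewrite /psi D0 mul0r normr0 expR0 subrr.
Qed.

Lemma law_of_constant d (Omega : measurableType d) (R : realType)
    (P : probability Omega R) (X : {RV P >-> R}) (c : R) :
  (forall w, X w = c) -> forall A, distribution P X A = \d_c A.
Proof.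
move=> Xc A; rewrite diracE; have [cA|cA] := boolP (c \in A).
  rewrite -(probability_setT P); congr (P _); apply/seteqP; split => // w _.
  by rewrite /preimage/= Xc; exact: set_mem.
transitivity (P set0); last by rewrite measure0.
congr (P _); apply/seteqP; split => // w.
by rewrite /preimage/= Xc => /mem_set cA'; rewrite cA' in cA.
Qed.

Theorem proposition3 (R : realType) (T : R) (T_gt0 : 0 < T)
    (d : measure_display) (Omega : measurableType d) (P : probability Omega R)
    (B : R -> {RV P >-> R}) (B_BM : standard_Brownian_motion P T B)
    (d' : measure_display) (Omega' : measurableType d')
    (P' : probability Omega' R)
    (xi : nat -> {RV P' >-> R}) (xi_iid : iid_signs P' xi) :
  exists2 C : R, 0 < C &
    forall (n : nat) (x t s : R), (1 <= n)%N -> 0 <= t -> t <= s -> s <= T ->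
      (W_psi P' P (started_at P' (random_walk P' T xi n) t x s)
              (started_at P B t x s)
         <= (C * Num.sqrt (T / n%:R))%:E)%E.
Proof.
(* 1204 = 4 * (300 + 1): the gap 300 + 60 * y ^+ 2 of the quantile coupling and
   the error 1 + y ^+ 2 of replacing sqrt (m + 1) by sqrt v add up
   to at most 1204 * (1 / 4 + y ^+ 2 / 4). *)
have C0 : 0 < 1204 :> R by rewrite ltr0n.
exists 1204; first exact: C0.
move=> n x t s n1 t0 ts sT.
have h0 : 0 < T / n%:R by rewrite divr_gt0// ltr0n.
set h := T / n%:R in h0 *; pose r := Num.sqrt h.
have r0 : 0 < r by rewrite /r sqrtr_gt0.
have a0 : 0 < 1204 * r by exact: mulr_gt0 C0 r0.
move: ts; rewrite le_eqVlt => /orP[/eqP ts|ts].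
  (* At equal times both laws are the point mass at x. *)
  have walk_cst w : started_at P' (random_walk P' T xi n) t x s w = x.
    rewrite -[LHS]/(x +
      (random_walk P' T xi n s w - random_walk P' T xi n t w)).
    by rewrite ts subrr addr0.
  have law1 : has_law P (cst x : {RV P >-> R})
      (distribution P' (started_at P' (random_walk P' T xi n) t x s)).
    move=> A mA; rewrite (law_of_constant walk_cst).
    exact: law_of_constant.
  apply: (le_trans (W_psi_le law1 (fun A _ => erefl))).
  apply: orlicz_norm0_le => // w.
  by rewrite -[LHS]/(x - (x + (B s w - B t w))) ts; ring.
case: B_BM => _ _ B_normal _.
pose sigma := Num.sqrt (s - t); pose W : {RV P >-> R} := B s - B t.
have sigma0 : 0 < sigma by rewrite sqrtr_gt0 subr_gt0.
have W_law : has_law P W (normal_prob 0 sigma) by exact: B_normal.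
pose a := Num.truncn (t / h); pose b := Num.truncn (s / h); pose m := (b - a)%N.
have [X [Xlaw Xgap]] := quantile_coupling_exists sigma0 W_law m x r0.
have Xlaw' : has_law P X
    (distribution P' (started_at P' (random_walk P' T xi n) t x s)).
  move=> A mA; rewrite Xlaw//.
  by rewrite (walk_increment_law xi_iid x h0 t0 (ltW ts) mA).
apply: (le_trans (W_psi_le Xlaw' (fun A _ => erefl))).
apply: (orlicz_norm_le_normal sigma0 W_law a0) => w.
suff gap : `|(X w - (x + W w)) / (1204 * r)| <=
    1 / 4 + (W w / sigma) ^+ 2 / 4 by exact: gap.
(* In units of h the elapsed time is v, within 2 of the variance M = m + 1. *)
pose y := W w / sigma; pose v := (s - t) / h; pose M : R := m.+1%:R.
have v0 : 0 <= v by rewrite divr_ge0 ?subr_ge0 ?(ltW h0) ?(ltW ts).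
have sigmaE : sigma = r * Num.sqrt v.
  by rewrite /r -sqrtrM ?(ltW h0)// /v mulrC divfK// gt_eqF.
have s0 : 0 <= s by exact: le_trans t0 (ltW ts).
have /andP[a1 a2] : a%:R <= t / h < a.+1%:R.
  by rewrite truncn_itv// divr_ge0// (ltW h0).
have /andP[b1 b2] : b%:R <= s / h < b.+1%:R.
  by rewrite truncn_itv// divr_ge0// (ltW h0).
have ab : (a <= b)%N.
  by apply: le_truncn; rewrite ler_wpM2r// ?invr_ge0 ?(ltW h0)// (ltW ts).
have vM : `|v - M| <= 2.
  rewrite /v /M -natr1 natrB// mulrBl.
  by move: a2 b2; rewrite -![_.+1%:R]natr1 ler_norml => a2 b2; lra.
have M1 : 1 <= M by rewrite ler1n.
have rootM : 1 <= Num.sqrt M by rewrite -[leLHS]sqrtr1 ler_wsqrtr.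
have roots : `|Num.sqrt M - Num.sqrt v| <= 2.
  have := sqrtr_ge0 v => q0.
  have : `|Num.sqrt M - Num.sqrt v| * (Num.sqrt M + Num.sqrt v) <= 2.
    rewrite -[X in _ * X]ger0_norm ?addr_ge0 ?sqrtr_ge0// -normrM.
    by rewrite -subr_sqr !sqr_sqrtr ?(le_trans ler01 M1)// distrC.
  by apply: le_trans; rewrite ler_peMr//; lra.
have e : (X w - (x + W w)) / (1204 * r) =
    (((X w - x) / r - Num.sqrt M * y) + (Num.sqrt M - Num.sqrt v) * y) / 1204.
  have -> : W w = r * Num.sqrt v * y by rewrite -sigmaE /y mulrC divfK// gt_eqF.
  by field; rewrite gt_eqF.
rewrite e normrM [ `|_^-1|]ger0_norm; last by rewrite invr_ge0 (ltW C0).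
rewrite (ler_pdivrMr _ _ C0).
apply: (le_trans (ler_normD _ _)); rewrite normrM.
have g1 := Xgap w.
have g2 : `|Num.sqrt M - Num.sqrt v| * `|y| <= 1 + y ^+ 2.
  apply: (@le_trans _ _ (2 * `|y|)); first by rewrite ler_wpM2r.
  have := sqr_ge0 (`|y| - 1); rewrite sqrrB1 real_normK ?num_real//.
  by lra.
apply: (le_trans (lerD g1 g2)); rewrite -/y.
by have := sqr_ge0 y; lra.
Qed.
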